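(* Let $D$ be an open or closed disk or an open or closed half-plane in $\mathbb{C}$. There is no matrix polynomial $P(\lambda)\in\mathbb{C}^{n,n}[\lambda]$ such that each element of its orbit $\{E(\lambda)P(\lambda)F(\lambda)\in\mathbb{C}^{n,n}[\lambda] : E(\lambda),F(\lambda)\in\mathcal{U}_n\}$ is hyperstable with respect to the set $D$.
   Context: Here $n$ is a positive integer, and $\mathbb{C}^{n,n}[\lambda]$ is the set of matrix polynomials in one complex variable $\lambda$ with complex $n\times n$ matrix coefficients. $\mathcal{U}_n$ is the group of unimodular matrix polynomials with coefficients of size $n\times n$, i.e. those $U(\lambda)\in\mathbb{C}^{n,n}[\lambda]$ for which $\det U(\lambda)$ is a nonzero constant. A matrix polynomial $P(\lambda)\in\mathbb{C}^{n,n}[\lambda]$ is regular if $\det P(\lambda)$ is not identically zero. A regular matrix polynomial $P(\lambda)\in\mathbb{C}^{n,n}[\lambda]$ is hyperstable with respect to a nonempty open or closed set $D\subseteq\mathbb{C}$ if and only if for all $x\in\mathbb{C}^n\setminus\{0\}$ there exists $y\in\mathbb{C}^n\setminus\{0\}$ such that $y^*P(\mu)x\neq0$ for all $\mu\in D$, where $y^*$ denotes the conjugate transpose of $y$.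
   Formalization: The formal theorem assumes n ≥ 2; for n = 1 the claim is false for every D, since the orbit of P = 1 consists of the nonzero constants, all of which are hyperstable with respect to D. *)

(* Defs.v *)
From HB Require Import structures.
From mathcomp Require Import all_boot all_order all_algebra.
From mathcomp Require Import classical_sets reals.
From mathcomp Require Import spectral.
From mathcomp Require Import complex.

Set Implicit Arguments.
Unset Strict Implicit.
Unset Printing Implicit Defensive.

Import Order.TTheory GRing.Theory Num.Theory.

Local Open Scope ring_scope.
Local Open Scope classical_set_scope.
Local Open Scope complex_scope.
Local Open Scope sesquilinear_scope.

Section Disks.
Variable R : realType.

Definition open_disk (c : R[i]) (r : R) : set R[i] :=
  [set z | `|z - c| < r%:C].

Definition closed_disk (c : R[i]) (r : R) : set R[i] :=
  [set z | `|z - c| <= r%:C].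

(* For a != 0, every half-plane has this form: its boundary is the line
   Re (a * z) = b, with inner normal the conjugate of a. *)
Definition open_half_plane (a : R[i]) (b : R) : set R[i] :=
  [set z | b < complex.Re (a * z)].

Definition closed_half_plane (a : R[i]) (b : R) : set R[i] :=
  [set z | b <= complex.Re (a * z)].

Definition is_disk (D : set R[i]) : Prop :=
  exists (c : R[i]) (r : R),
    0 < r /\ (D = open_disk c r \/ D = closed_disk c r).

Definition is_half_plane (D : set R[i]) : Prop :=
  exists (a : R[i]) (b : R),
    a != 0 /\ (D = open_half_plane a b \/ D = closed_half_plane a b).

End Disks.

(* Matrix polynomials are represented as matrices with polynomial entries. *)
Section MatrixPolynomials.
Variables (R : realType) (n : nat).

Definition mxpoly_eval (P : 'M[{poly R[i]}]_n) (mu : R[i]) : 'M[R[i]]_n :=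
  map_mx (fun p : {poly R[i]} => p.[mu]) P.

Definition unimodular : set 'M[{poly R[i]}]_n :=
  [set U | exists2 c : R[i], c != 0 & \det U = c%:P].

Definition regular (P : 'M[{poly R[i]}]_n) : Prop := \det P != 0.

Definition hyperstable (D : set R[i]) (P : 'M[{poly R[i]}]_n) : Prop :=
  regular P /\
  forall x : 'cV[R[i]]_n, x != 0 ->
    exists2 y : 'cV[R[i]]_n, y != 0 &
      forall mu : R[i], D mu -> y ^t* *m mxpoly_eval P mu *m x != 0.

Definition unimodular_orbit (P : 'M[{poly R[i]}]_n) :
    set 'M[{poly R[i]}]_n :=
  [set E *m P *m F | E in unimodular & F in unimodular].

End MatrixPolynomials.

(* Main.v *)
Require Import Defs.
From mathcomp Require Import all_boot all_order all_algebra.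
From mathcomp Require Import classical_sets reals.
From mathcomp Require Import complex.
From mathcomp Require Import ring lra.

(** The first column of [P] is reduced by row transvections, as in the
    Euclidean algorithm, to a vector with a single nonzero entry [g]; two more
    transvections turn it into a vector whose nonzero entries are
    [(1 + w^2) g] and [w g], where [w] is an affine polynomial mapping some
    disk inside [D] onto a disk of radius [2] around [0]. A combination
    [a (1 + w^2) + b w] with [a != 0] has two roots [w] whose product is [1],
    so one of them satisfies [|w| <= 1], and for [a = 0] the root is [w = 0];
    hence every linear combination of the entries
    of this column vanishes somewhere in [D]. *)

Import Order.TTheory GRing.Theory Num.Theory.

Local Open Scope ring_scope.
Local Open Scope complex_scope.

(** The matrix is triangular with unit diagonal; transposition reduces the upper triangular case to
    the lower one. *)
Lemma det_transvection (K : comNzRingType) (n : nat) (i j : 'I_n) (c : K) :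
  i != j -> \det (1%:M + c *: delta_mx i j) = 1.
Proof.
have trig (k l : 'I_n) : (l < k)%N -> \det (1%:M + c *: delta_mx k l) = 1.
  move=> ltlk; rewrite det_trig.
    apply: big1 => a _; rewrite !mxE eqxx.
    case: (eqVneq a k) => [->|_]; last by rewrite mulr0 addr0.
    by rewrite -val_eqE /= gtn_eqF // mulr0 addr0.
  apply/is_trig_mxP => a b ltab; rewrite !mxE -!val_eqE /= ltn_eqF // add0r.
  case: eqP => [eak|_]; last by rewrite mulr0.
  case: eqP => [ebl|_]; last by rewrite mulr0.
  by move: ltab; rewrite eak ebl ltnNge (ltnW ltlk).
rewrite neq_ltn => /orP[ltij|ltji]; last exact: trig.
by rewrite -det_tr linearD linearZ /= trmx_delta trmx1 trig.
Qed.

Lemma transvectionE (K : comNzRingType) (n : nat) (i j a : 'I_n) (c : K)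
    (p : 'cV[K]_n) :
  ((1%:M + c *: delta_mx i j) *m p) a 0
  = if a == i then p a 0 + c * p j 0 else p a 0.
Proof.
rewrite mulmxDl mul1mx -scalemxAl !mxE (bigD1 j) //= big1 => [|b nbj].
  by rewrite !mxE eqxx andbT addr0; case: eqP; rewrite ?mul1r // mul0r mulr0 addr0.
by rewrite !mxE (negPf nbj) andbF mul0r.
Qed.

(** Induction on the sum of the sizes of the entries: while two entries are nonzero, replacing the
    larger by its remainder modulo the smaller lowers this sum. *)
Lemma col_poly_reduce (K : fieldType) (n : nat) (n_gt0 : (0 < n)%N)
    (p : 'cV[{poly K}]_n) :
  exists (U : 'M[{poly K}]_n) (k : 'I_n), \det U = 1 /\
    forall i, i != k -> (U *m p) i 0 = 0.
Proof.
have [m] := ubnP (\sum_i size (p i 0%R)); elim: m p => // m IHm p lt_p_m.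
have [k pk|p0] := pickP (fun k => p k 0 != 0); last first.
  exists 1%:M, (Ordinal n_gt0); split=> [|i _]; first exact: det1.
  by rewrite mul1mx; apply/eqP/negbFE/p0.
have [l /andP[nlk pl]|p0] := pickP (fun l => (l != k) && (p l 0 != 0));
  last first.
  exists 1%:M, k; split=> [|i nik]; first exact: det1.
  by rewrite mul1mx; apply/eqP; move: (p0 i); rewrite nik => /negbFE.
have [i [j [nij pi lepij]]] : exists i j : 'I_n,
    [/\ j != i, p i 0 != 0 & (size (p i 0%R) <= size (p j 0%R))%N].
  case/orP: (leq_total (size (p k 0%R)) (size (p l 0%R))) => le.
    by exists k, l.
  by exists l, k; split=> //; rewrite eq_sym.
pose T : 'M[{poly K}]_n := 1%:M + (- (p j 0 %/ p i 0)) *: delta_mx j i.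
have Tp a : (T *m p) a 0 = if a == j then p j 0 %% p i 0 else p a 0.
  rewrite transvectionE; case: eqP => // ->.
  by rewrite {1}(divp_eq (p j 0) (p i 0)); ring.
have [|U [h [detU Uh]]] := IHm (T *m p).
  apply: leq_trans (_ : \sum_a size (p a 0%R) <= m)%N; last by [].
  rewrite (bigD1 j) //= [X in (_ < X)%N](bigD1 j) //= Tp eqxx.
  rewrite -addSn leq_add //; first by rewrite (leq_trans _ lepij) // ltn_modp.
  by apply: leq_sum => a naj; rewrite Tp (negPf naj).
exists (U *m T), h; split=> [|a nah]; last by rewrite -mulmxA Uh.
by rewrite det_mulmx detU det_transvection // mulr1.
Qed.

Lemma palindromic_root (C : numClosedFieldType) (a b : C) :
  exists2 w : C, `|w| <= 1 & a * (1 + w ^+ 2) + b * w = 0.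
Proof.
have [->|a0] := eqVneq a 0; first by exists 0; rewrite ?normr0 ?ler01 //; ring.
have [w] := @solve_monicpoly C 2 (fun i => if i == 0%N then -1 else - (b / a)) isT.
rewrite !big_ord_recl big_ord0 /= expr0 expr1 => w2.
have wP : a * (1 + w ^+ 2) + b * w = 0 by rewrite w2; field.
have w0 : w != 0.
  by apply: contra_neq a0 => we; move: wP; rewrite we => <-; ring.
have [le1|gt1] := real_leP (normr_real w) (real1 C); first by exists w.
(* The other root: dividing the equation at [w] by [w ^+ 2] gives the equation at [w^-1]. *)
exists w^-1; first by rewrite normfV invf_le1 ?(ltW gt1) // normr_gt0.
by rewrite -[RHS](mul0r (w ^- 2)) -wP; field.
Qed.

Lemma open_disk_sub (R : realType) (D : set R[i]) :
  is_disk D \/ is_half_plane D ->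
  exists (c : R[i]) (r : R), 0 < r /\ forall z, open_disk c r z -> D z.
Proof.
case=> [[c [r [r0 [->|->]]]]|[a [b [a0 Dab]]]].
- by exists c, r.
- by exists c, r; split=> // z; apply: ltW.
(* Since [a * c = b + 1], radius [1 / |a|] keeps [a * z] within distance 1 of [b + 1], so its real
   part exceeds [b]. *)
pose c := (b + 1)%:C / a.
have na0 : 0 < `|a| by rewrite normr_gt0.
have na : `|a| = (complex.Re `|a|)%:C by rewrite RRe_real // normr_real.
have sa0 : 0 < complex.Re `|a| by move: na0; rewrite {1}na ltcR.
exists c, (complex.Re `|a|)^-1; split=> [|z]; first by rewrite invr_gt0.
rewrite /open_disk /= => zc.
suff lt_b : b < complex.Re (a * z) by case: Dab => ->; last exact: ltW.
have : `|a * z - (b + 1)%:C| < 1.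
  have -> : a * z - (b + 1)%:C = a * (z - c) by rewrite /c; field.
  by rewrite normrM -ltr_pdivlMl // mulr1 na -fmorphV.
move=> /(le_lt_trans (normc_ge_Re _)); rewrite ltcR => h.
have {h} : `|complex.Re (a * z) - (b + 1)| < 1 by case: (a * z) h.
by rewrite ltr_norml => /andP[h _]; lra.
Qed.

(* For n = 1 the claim fails: the orbit of P = 1 consists of the nonzero
   constants, all of which are hyperstable. *)
Theorem theorem2p10 (R : realType) (n : nat) (n_gt1 : (1 < n)%N)
    (D : set R[i]) (D_shape : is_disk D \/ is_half_plane D) :
  ~ exists P : 'M[{poly R[i]}]_n,
      forall Q : 'M[{poly R[i]}]_n,
        unimodular_orbit P Q -> hyperstable D Q.
Proof.
case=> P hP.
have [c [r [r0 sD]]] := open_disk_sub _ _ D_shape.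
have n_gt0 := ltnW n_gt1.
pose o := Ordinal n_gt0.
have [U [k [detU Uk]]] := col_poly_reduce _ _ n_gt0 (col o P).
have [l nlk] : exists l : 'I_n, l != k.
  have [->|nko] := eqVneq k o; first by exists (Ordinal n_gt1).
  by exists o; rewrite eq_sym.
pose s : R[i] := (2 / r)%:C.
pose w : {poly R[i]} := s *: ('X - c%:P).
pose T1 : 'M[{poly R[i]}]_n := 1%:M + w *: delta_mx l k.
pose T2 : 'M[{poly R[i]}]_n := 1%:M + w *: delta_mx k l.
pose E := T2 *m (T1 *m U).
have detE : \det E = 1.
  by rewrite !det_mulmx detU !det_transvection ?mulr1 // eq_sym.
pose g := (U *m col o P) k 0.
(* [T1] puts [w * g] in row [l]; [T2] then adds [w * (w * g)] to the entry [g] in row [k]. *)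
have EP i : (E *m col o P) i 0
    = if i == k then (1 + w ^+ 2) * g else if i == l then w * g else 0.
  rewrite /E -!mulmxA !transvectionE eqxx (Uk _ nlk) -/g.
  have [->|nik] := eqVneq i k; first by rewrite eq_sym (negPf nlk) -/g; ring.
  by rewrite (Uk _ nik) add0r.
(* Testing on this basis vector selects column [o] of [E *m P]. *)
have [|_ /(_ (delta_mx o 0))] := hP (E *m P).
  exists E; first by exists 1; rewrite ?oner_neq0.
  exists 1%:M; first by exists 1; rewrite ?oner_neq0 // det1.
  by rewrite mulmx1.
case.
  by apply/eqP => /matrixP/(_ o 0); rewrite !mxE !eqxx => /eqP; rewrite oner_eq0.
move=> y _ hy.
have [v lev hv] := palindromic_root _ (y k 0)^*%R (y l 0)^*%R.
(* The preimage of [v] under [w]. As [|v| <= 1], it lies within [r / 2] of [c], hence in the open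
   disk. *)
pose mu := c + (r / 2)%:C * v.
have wmu : w.[mu] = v.
  rewrite /w /mu /s !hornerE addrC addKr mulrA -rmorphM /=.
  have -> : 2 / r * (r / 2) = 1 by field; rewrite gt_eqF.
  by rewrite mul1r.
have /hy/eqP : D mu.
  apply: sD; rewrite /open_disk /= /mu addrC addKr normrM normc_def /=.
  rewrite expr0n addr0 sqrtr_sqr gtr0_norm ?divr_gt0 //.
  apply: le_lt_trans (_ : (r / 2)%:C < _); last by rewrite ltcR; lra.
  by rewrite ler_piMr // lecR divr_ge0 // ltW.
apply.
apply/matrixP => a b; rewrite !ord1 -mulmxA -colE.
have -> : col o (mxpoly_eval (E *m P) mu)
    = map_mx (fun p : {poly R[i]} => p.[mu]) (E *m col o P).
  by rewrite [col o P]colE mulmxA -colE; apply/matrixP => i j; rewrite !mxE.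
(* With [w] opaque, evaluation stops at [w.[mu]], where [wmu] applies. *)
move: (E *m col o P) EP => q qE; clearbody w g.
rewrite !mxE (bigD1 k) //= (bigD1 l) //= big1 => [|i /andP[nik nil]].
  rewrite !mxE !qE eqxx (negPf nlk) eqxx !hornerE wmu.
  by rewrite /= addr0 -mulrDl hv mul0r.
by rewrite mxE [X in _ * X]mxE qE (negPf nik) (negPf nil) horner0 mulr0.
Qed.
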